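(* Let $\mathfrak g=\mathfrak g_{-1}\oplus\mathfrak g_0\oplus\mathfrak g_1$ be a simple complex Lie algebra with a nontrivial short grading, let $(V_+,V_-)=(\mathfrak g_1,\mathfrak g_{-1})$ be the corresponding Jordan pair, let $\omega$ be a Cartan involution of this Jordan pair, and let $\tilde\omega$ be the corresponding Cartan involution of $\mathfrak g$, with $\mathfrak k_0=\mathfrak g_0^{\tilde\omega}$. Then the Jordan-pair definition of the Moore--Penrose inverse coincides with the Lie-algebra definition: for $A\in V_\pm$, an element $A^+\in V_\mp$ is a Moore--Penrose inverse of $A$ in the Jordan-pair sense (with respect to $\omega$) if and only if it is a Moore--Penrose inverse of $A$ in the Lie-algebra sense (with respect to $\mathfrak k_0$). In particular, a Moore--Penrose inverse in the Jordan pair exists and is unique for every $A\in V_\pm$.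
   Context: Jordan pair of a shortly graded Lie algebra: $V_+=\mathfrak g_1$, $V_-=\mathfrak g_{-1}$, with trilinear products $V_\pm\times V_\mp\times V_\pm\to V_\pm$, $\{x,y,z\}=\{xyz\}=\tfrac12[[x,y],z]$. Only Jordan pairs arising in this way from simple complex $\mathfrak g$ are considered. Killing pairing: $B(x,y)=\mathrm{Tr}\{x,y,\cdot\}$ for $x\in V_\pm$, $y\in V_\mp$ (trace of the operator $z\mapsto\{x,y,z\}$ on $V_\pm$). Cartan involution of the Jordan pair: a pair $\omega$ of antilinear maps $V_\pm\to V_\mp$ such that $\omega^2=\mathrm{Id}$, $\{\omega(x),\omega(y),\omega(z)\}=\omega\{x,y,z\}$, and the Hermitian form $H(x)=B(x,\omega(x))$ is positive definite on $V_+$ and on $V_-$. Such $\omega$ correspond bijectively to Cartan involutions $\tilde\omega$ of $\mathfrak g$ (antilinear involutive automorphisms whose fixed-point algebra is a compact real form of $\mathfrak g$) with $\tilde\omega(\mathfrak g_k)=\mathfrak g_{-k}$, via $\omega=-\tilde\omega|_{\mathfrak g_{-1}\oplus\mathfrak g_1}$. Jordan-pair definition: for $A\in V_\pm$, a Moore--Penrose inverse is an element $A^+\in V_\mp$ such that $\{AA^+A\}=A$, $\{A^+AA^+\}=A^+$, and the operators $\{A\,A^+\,\cdot\}$ on $V_\pm$ and $\{A^+A\,\cdot\}$ on $V_\mp$ are Hermitian with respect to $H$. Lie-algebra definition: an $\mathfrak{sl}_2$-triple $\langle e,h,f\rangle$ satisfies $[e,f]=h$, $[h,e]=2e$, $[h,f]=-2f$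 (elements may be zero). For $e\in\mathfrak g_{\pm1}$, an element $f\in\mathfrak g_{\mp1}$ is a Moore--Penrose inverse of $e$ (with respect to the compact real form $\mathfrak k_0$ of $\mathfrak g_0$) if there is an $\mathfrak{sl}_2$-triple $\langle e,h,f\rangle$ with $h\in i\mathfrak k_0$. *)

(* Defs.v *)
From HB Require Import structures.
From mathcomp Require Import all_boot all_order all_algebra.
From mathcomp Require Export complex.
From mathcomp Require Export reals.

Set Implicit Arguments.
Unset Strict Implicit.
Unset Printing Implicit Defensive.

Import Order.TTheory GRing.Theory Num.Theory.
Local Open Scope ring_scope.

HB.mixin Record Vector_isLieAlgebra (K : fieldType) L of Vector K L := {
  lie : L -> L -> L;
  lie_linear_l : forall y, linear (lie^~ y);
  lie_linear_r : forall x, linear (lie x);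
  liexx : forall x, lie x x = 0;
  lie_jacobi : forall x y z,
    lie x (lie y z) + lie y (lie z x) + lie z (lie x y) = 0
}.

#[short(type="lieAlgType")]
HB.structure Definition LieAlgebra (K : fieldType) :=
  {L of Vector K L & Vector_isLieAlgebra K L}.

Section LieAlgebra.
Variables (K : fieldType) (L : lieAlgType K).

Definition is_ideal (I : {vspace L}) : Prop :=
  forall x y : L, y \in I -> lie x y \in I.

Definition simple_lie : Prop :=
  (exists x y : L, lie x y != 0) /\
  (forall I : {vspace L}, is_ideal I -> I = 0%VS \/ I = fullv).

(* Only meaningful when f maps V linearly into itself; then it is the trace of
   the restriction of f to V. *)
Definition trace_on (V : {vspace L}) (f : L -> L) : K :=
  \tr (\matrix_(i < \dim V, j < \dim V)
         coord (vbasis V) j (f (vbasis V)`_i)).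

Definition killing (x y : L) : K :=
  trace_on fullv (fun z => lie x (lie y z)).

Definition sl2_triple (e h f : L) : Prop :=
  [/\ lie e f = h, lie h e = 2%:R *: e & lie h f = - (2%:R *: f)].

Definition short_grading (g : int -> {vspace L}) : Prop :=
  [/\ directv (g (-1)%R + g 0%R + g 1%R),
      (g (-1)%R + g 0%R + g 1%R)%VS = fullv,
      (forall k : int, 1 < `|k| -> g k = 0%VS)
    & forall (j k : int) (x y : L),
        x \in g j -> y \in g k -> lie x y \in g (j + k)].

Definition nontrivial_grading (g : int -> {vspace L}) : Prop :=
  g 0 <> fullv.

(* V_+ is jpair g true and V_- is jpair g false. *)
Definition jpair (g : int -> {vspace L}) (s : bool) : {vspace L} :=
  if s then g 1 else g (-1).

(* Used with x and z in V_s and y in V_(-s). *)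
Definition jprod (x y z : L) : L := 2%:R^-1 *: lie (lie x y) z.

Definition killing_pairing (g : int -> {vspace L}) (s : bool) (x y : L) : K :=
  trace_on (jpair g s) (jprod x y).

End LieAlgebra.

Section Involutions.
Variables (C : numClosedFieldType) (L : lieAlgType C).

(* "0 > killing x x" in C says that killing x x is real and negative.  The fixed
   points of an antilinear involutive automorphism form a real form k of L, and
   the Killing form of k is the restriction to k of the one of L (a real basis
   of k is a complex basis of L), so the last clause says that k is compact. *)
Definition lie_cartan_involution (wt : L -> L) : Prop :=
  [/\ linear_for (Num.conj \; *:%R) wt,
      (forall x, wt (wt x) = x),
      (forall x y, wt (lie x y) = lie (wt x) (wt y))
    & forall x, wt x = x -> x != 0 -> killing x x < 0].

Variable g : int -> {vspace L}.
Local Notation V := (jpair g).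

(* The pair of maps V_+ -> V_-, V_- -> V_+ is encoded as one function on L, whose
   values outside V_+ and V_- are irrelevant (V_+ and V_- meet only in 0). *)
Section JordanInvolution.
Variable w : L -> L.

Definition hform (s : bool) (x y : L) : C := killing_pairing g s x (w y).

Definition jordan_cartan_involution : Prop :=
  forall s : bool,
  [/\ (forall x, x \in V s -> w x \in V (~~ s)),
      (forall (a : C) x y, x \in V s -> y \in V s ->
         w (a *: x + y) = Num.conj a *: w x + w y),
      (forall x, x \in V s -> w (w x) = x),
      (forall x y z, x \in V s -> y \in V (~~ s) -> z \in V s ->
         jprod (w x) (w y) (w z) = w (jprod x y z))
    & forall x, x \in V s -> x != 0 -> 0 < hform s x x].

Definition hermitian_operator (s : bool) (T : L -> L) : Prop :=
  forall x y, x \in V s -> y \in V s -> hform s (T x) y = hform s x (T y).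

Definition jordan_MP_inverse (s : bool) (A A' : L) : Prop :=
  A' \in V (~~ s) /\
  [/\ jprod A A' A = A, jprod A' A A' = A',
      hermitian_operator s (jprod A A')
    & hermitian_operator (~~ s) (jprod A' A)].

Definition corresponding_involutions (wt : L -> L) : Prop :=
  [/\ lie_cartan_involution wt,
      (forall (k : int) x, x \in g k -> wt x \in g (- k))
    & forall s x, x \in V s -> w x = - wt x].

End JordanInvolution.

Definition k0 (wt : L -> L) (u : L) : Prop := u \in g 0 /\ wt u = u.

Definition lie_MP_inverse (wt : L -> L) (s : bool) (e f : L) : Prop :=
  f \in V (~~ s) /\
  exists h, sl2_triple e h f /\ exists2 u, k0 wt u & h = 'i *: u.

End Involutions.

(* Main.v *)
Require Import Defs.
From HB Require Import structures.
From mathcomp Require Import all_boot all_order all_algebra.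
From mathcomp Require Import complex reals.

(** Put [a^(0) = A] and [a^(k+1) = {A, w A, a^(k)}]. The elements
    [[a^(k), w a^(l)]] depend only on [k + l], so [p |-> E p = \sum_k p_k a^(k)]
    satisfies [{E p, w (E q), E r} = E (p q^* r X)], where [q^*] has the
    conjugate coefficients. If [E (p X) = 0], then [[E p, w (E p)]] commutes with
    [E p]; it is thus nilpotent by Jacobson's lemma, hence zero by hermitianity,
    and positivity of [H] gives [E p = 0]. So the annihilator of [A] contains some
    [1 - r X], and [w (E r)] is a Moore-Penrose inverse of [A]. Jacobson's lemma
    also shows that [[A, A1 - A2]] acts trivially when [A1] and [A2] are two
    Moore-Penrose inverses, and this forces [A1 = A2].

    Given [A'] with [{A A' A} = A] and [{A' A A'} = A'], put [h = [A, A']].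
    Hermitianity of [{A A' .}] says that [h + wt h] acts trivially on [V_+] and
    [V_-]; by simplicity this means [wt h = - h]. *)

Set Implicit Arguments.
Unset Strict Implicit.
Unset Printing Implicit Defensive.

Import Order.TTheory GRing.Theory Num.Theory.
Local Open Scope ring_scope.

(** * Bracket identities, traces on subspaces and families of powers *)

Section LieAlgebraTheory.
Variables (K : fieldType) (L : lieAlgType K).
Implicit Types (x y z u : L) (V : {vspace L}) (p q : {poly K}).

HB.instance Definition _ x :=
  GRing.isLinear.Build K L L *:%R (lie x) (lie_linear_r x).

Lemma lieDr x y z : lie x (y + z) = lie x y + lie x z.
Proof. exact: (linearD (lie x)). Qed.

Lemma lieZr a x y : lie x (a *: y) = a *: lie x y.
Proof. exact: (linearZ_LR (lie x)). Qed.

Lemma lieNr x y : lie x (- y) = - lie x y.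
Proof. exact: (linearN (lie x)). Qed.

Lemma lieBr x y z : lie x (y - z) = lie x y - lie x z.
Proof. exact: (linearB (lie x)). Qed.

Lemma lie0r x : lie x 0 = 0.
Proof. exact: (linear0 (lie x)). Qed.

Lemma lie_sumr I (r : seq I) (P : pred I) (F : I -> L) x :
  lie x (\sum_(i <- r | P i) F i) = \sum_(i <- r | P i) lie x (F i).
Proof. exact: (linear_sum (lie x)). Qed.

Lemma lieC x y : lie x y = - lie y x.
Proof.
apply/eqP; rewrite -addr_eq0; apply/eqP.
have lieDl (a b c : L) : lie (a + b) c = lie a c + lie b c.
  by rewrite -[a]scale1r lie_linear_l !scale1r.
by have := liexx (x + y); rewrite lieDr !lieDl !liexx add0r addr0 addrC.
Qed.

Lemma lieDl x y z : lie (x + y) z = lie x z + lie y z.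
Proof. by rewrite lieC lieDr opprD -!(lieC _ z). Qed.

Lemma lieNl x y : lie (- x) y = - lie x y.
Proof. by rewrite lieC lieNr opprK lieC. Qed.

Lemma lieBl x y z : lie (x - y) z = lie x z - lie y z.
Proof. by rewrite lieDl lieNl. Qed.

Lemma lieZl a x y : lie (a *: x) y = a *: lie x y.
Proof. by rewrite lieC lieZr -scalerN -lieC. Qed.

Lemma lie0l x : lie 0 x = 0.
Proof. by rewrite lieC lie0r oppr0. Qed.

Lemma lie_suml I (r : seq I) (P : pred I) (F : I -> L) y :
  lie (\sum_(i <- r | P i) F i) y = \sum_(i <- r | P i) lie (F i) y.
Proof. by rewrite lieC lie_sumr -sumrN; apply: eq_bigr => i _; rewrite -lieC. Qed.

Lemma lie_leibniz x y z : lie x (lie y z) = lie (lie x y) z + lie y (lie x z).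
Proof.
apply/eqP; rewrite -subr_eq0 opprD; apply/eqP.
have := lie_jacobi x y z; rewrite (lieC z (lie x y)) (lieC z x) lieNr.
by rewrite addrAC addrA.
Qed.

Lemma lie_leibnizl x y z : lie (lie x y) z = lie x (lie y z) - lie y (lie x z).
Proof. by rewrite lie_leibniz addrK. Qed.

(** Makes the triple product symmetric in its outer arguments. *)
Lemma lie_swap x y z : lie x z = 0 -> lie (lie x y) z = lie (lie z y) x.
Proof.
move=> xz0; rewrite lie_leibnizl xz0 lie0r subr0.
by rewrite (lieC x) (lieC y) lieNl opprK.
Qed.

Lemma trace_onD V (f1 f2 : L -> L) :
  trace_on V (fun x => f1 x + f2 x) = trace_on V f1 + trace_on V f2.
Proof.
rewrite /trace_on -linearD; congr (\tr _); apply/matrixP => i j.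
by rewrite !mxE linearD.
Qed.

Lemma trace_onZ V a (f : L -> L) :
  trace_on V (fun x => a *: f x) = a * trace_on V f.
Proof.
rewrite /trace_on -linearZ; congr (\tr _); apply/matrixP => i j.
by rewrite !mxE linearZ.
Qed.

Lemma eq_in_trace_on V (f1 f2 : L -> L) :
  {in V, f1 =1 f2} -> trace_on V f1 = trace_on V f2.
Proof.
move=> eqf; congr (\tr _); apply/matrixP => i j; rewrite !mxE eqf //.
by rewrite vbasis_mem ?mem_nth ?size_tuple.
Qed.

(** Images are stored as rows, so composition on a stable subspace is the matrix product in reverse
    order. *)
Lemma trace_on_comp V (f1 f2 : {linear L -> L}) :
    {in V, forall x, f1 x \in V} -> {in V, forall x, f2 x \in V} ->
  trace_on V (f1 \o f2) = trace_on V (f2 \o f1).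
Proof.
have mulE (f f' : {linear L -> L}) : {in V, forall x, f' x \in V} ->
    trace_on V (f \o f') =
    \tr ((\matrix_(i < \dim V, j < \dim V) coord (vbasis V) j (f' (vbasis V)`_i))
      *m (\matrix_(i < \dim V, j < \dim V) coord (vbasis V) j (f (vbasis V)`_i))).
  move=> Vf'; rewrite /trace_on; congr (\tr _); apply/matrixP => i j.
  rewrite !mxE /= [in LHS](coord_vbasis (Vf' _ _)).
    by rewrite linear_sum linear_sum; apply: eq_bigr => k _; rewrite !mxE !linearZ.
  by rewrite vbasis_mem ?mem_nth ?size_tuple.
by move=> Vf1 Vf2; rewrite !mulE // mxtrace_mulC.
Qed.

(* By induction [[e_k, f_(m-k)]] is independent of [k]; let [c] be its bracket with
   [h_0 = [e_0, f_0]], and [X_k = [e_k, f_(m+1-k)]]. Then [X_(k+1) - X_k = c / 2],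
   whereas expanding [c] in [h_0] gives [X_(m+1) - X_0 = - c / 2], so [c = 0]. *)
Lemma lie_powers (e f : nat -> L) : [pchar K] =i pred0 ->
    (forall k l, lie (e k) (e l) = 0) -> (forall k l, lie (f k) (f l) = 0) ->
    (forall k, lie (lie (e 0%N) (f 0%N)) (e k) = 2%:R *: e k.+1) ->
    (forall k, lie (lie (e 0%N) (f 0%N)) (f k) = - (2%:R *: f k.+1)) ->
  forall k l, lie (e k) (f l) = lie (e 0%N) (f (k + l)%N).
Proof.
move=> ch0 ee ff he hf; set h0 := lie (e 0%N) (f 0%N) in he hf.
have nz n : n.+1%:R != 0 :> K by have /pcharf0P -> := ch0.
suff main m k : (k <= m)%N -> lie (e k) (f (m - k)%N) = lie (e 0%N) (f m).
  by move=> k l; rewrite -(main (k + l)%N k) ?leq_addr // addKn.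
elim: m k => [|m IHm] k; first by rewrite leqn0 => /eqP->.
set c := lie h0 (lie (e 0%N) (f m)).
have step j : (j <= m)%N ->
    2%:R *: lie (e j.+1) (f (m - j)%N) = c + 2%:R *: lie (e j) (f (m.+1 - j)%N).
  move=> lejm; rewrite /c -(IHm j) // lie_leibniz he hf lieZl lieNr lieZr.
  by rewrite -/(_ - _) subSn // subrK.
have prog j : (j <= m.+1)%N ->
    2%:R *: lie (e j) (f (m.+1 - j)%N) = j%:R *: c + 2%:R *: lie (e 0%N) (f m.+1).
  elim: j => [|j IHj] lejm; first by rewrite subn0 scale0r add0r.
  by rewrite subSS step // IHj ?(ltnW lejm) // addrA -{1}[c]scale1r -scalerDl nat1r.
suff c0 : c = 0.
  move=> /prog; rewrite c0 scaler0 add0r => /scalerI; apply.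
  by rewrite (nz 1%N).
have hme : lie (lie (e 0%N) (f m)) (e 0%N) = 2%:R *: e m.+1.
  by rewrite -(IHm m) // subnn lie_swap.
have hmf : lie (lie (e 0%N) (f m)) (f 0%N) = - (2%:R *: f m.+1).
  by rewrite (lieC (e 0%N)) lieNl lie_swap // -lieNl -lieC hf.
have cE : c = 2%:R *: lie (e 0%N) (f m.+1) - 2%:R *: lie (e m.+1) (f 0%N).
  rewrite /c lieC lie_leibniz hme hmf lieZl lieNr lieZr opprD opprK addrC.
  by [].
have := prog m.+1 (leqnn _); rewrite subnn => pE.
move: cE; rewrite pE opprD addrCA subrr addr0 => /eqP.
rewrite -addr_eq0 -{1}[c]scale1r -scalerDl nat1r scaler_eq0 (negPf (nz _)) /=.
by move/eqP.
Qed.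

(** Swapping [e 0] and [e l], then sliding indices by [lie_powers], reduces the bracket to that of
    [[e_0, f_0]] with [e_(k+l)]. *)
Lemma lie_powers3 (e f : nat -> L) : [pchar K] =i pred0 ->
    (forall k l, lie (e k) (e l) = 0) -> (forall k l, lie (f k) (f l) = 0) ->
    (forall k, lie (lie (e 0%N) (f 0%N)) (e k) = 2%:R *: e k.+1) ->
    (forall k, lie (lie (e 0%N) (f 0%N)) (f k) = - (2%:R *: f k.+1)) ->
  forall k l, lie (lie (e 0%N) (f k)) (e l) = 2%:R *: e (k + l).+1.
Proof.
move=> ch0 ee ff he hf k l; have efE := lie_powers ch0 ee ff he hf.
by rewrite lie_swap // efE -[(l + k)%N]addn0 -efE lie_swap // he addnC.
Qed.

(** * Combinations of a sequence of vectors with polynomial coefficients *)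

Definition poly_comb (e : nat -> L) (p : {poly K}) : L :=
  \sum_(i < size p) p`_i *: e i.

Lemma poly_comb_widen e n p : (size p <= n)%N ->
  poly_comb e p = \sum_(i < n) p`_i *: e i.
Proof.
move=> le_pn; rewrite /poly_comb (big_ord_widen n (fun i => p`_i *: e i)) //.
rewrite [RHS](bigID (fun i : 'I_n => (i < size p)%N)) /=.
rewrite [X in _ + X]big1 ?addr0 // => i; rewrite -leqNgt => lepi.
by rewrite nth_default ?scale0r.
Qed.

Lemma poly_comb_is_linear e : linear (poly_comb e).
Proof.
move=> a p q; set n := maxn (size p) (size q).
have len : (size ((a *: p + q)%R : {poly K}) <= n)%N.
  apply: leq_trans (size_polyD _ _) _.
  by rewrite geq_max leq_maxr andbT (leq_trans (size_scale_leq _ _)) ?leq_maxl.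
rewrite !(@poly_comb_widen _ n) ?leq_maxl ?leq_maxr //.
rewrite scaler_sumr -big_split; apply: eq_bigr => i _ /=.
by rewrite coefD coefZ scalerDl scalerA.
Qed.

HB.instance Definition _ e :=
  GRing.isLinear.Build K {poly K} L *:%R (poly_comb e) (poly_comb_is_linear e).

Lemma poly_combB e p q : poly_comb e (p - q) = poly_comb e p - poly_comb e q.
Proof. exact: linearB. Qed.

Lemma poly_combXn e k : poly_comb e 'X^k = e k.
Proof.
rewrite /poly_comb size_polyXn big_ord_recr /= coefXn eqxx scale1r.
by rewrite big1 ?add0r // => i _; rewrite coefXn (ltn_eqF (ltn_ord i)) scale0r.
Qed.

(** Bilinear extension of a rule on indices; a uniform index shift by [n] becomes the factor
    ['X^n]. *)
Lemma lie_poly_comb (e f h : nat -> L) (n : nat) :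
    (forall k l, lie (e k) (f l) = h (k + l + n)%N) ->
  forall p q, lie (poly_comb e p) (poly_comb f q) = poly_comb h (p * q * 'X^n).
Proof.
move=> efE p q.
rewrite -[in RHS](coefK p) poly_def !mulr_suml (linear_sum (poly_comb h)).
rewrite [poly_comb e p]/poly_comb lie_suml; apply: eq_bigr => i _.
rewrite -[in RHS](coefK q) poly_def mulr_sumr mulr_suml (linear_sum (poly_comb h)).
rewrite [poly_comb f q]/poly_comb lie_sumr; apply: eq_bigr => j _.
rewrite lieZl lieZr efE -scalerAr -!scalerAl -!exprD !(linearZ_LR (poly_comb h)).
by rewrite /= poly_combXn !scalerA mulrC.
Qed.

Import VectorInternalTheory.

(** The first [dim L + 1] vectors are dependent; a kernel row of their matrix supplies the
    coefficients. *)
Lemma poly_comb_dependent e : exists2 p, p != 0 & poly_comb e p = 0.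
Proof.
set n := dim L; pose M := \matrix_(i < n.+1) v2r (e i).
have kM0 : kermx M != 0.
  by rewrite -mxrank_eq0 mxrank_ker subn_eq0 -ltnNge ltnS rank_leq_col.
pose v := nz_row (kermx M).
have v0 : v != 0 by rewrite nz_row_eq0.
have vM : v *m M = 0 by apply/sub_kermxP/nz_row_sub.
exists (\poly_(i < n.+1) v 0 (inord i)).
  apply: contraNneq v0 => /polyP p0; apply/eqP/rowP => i.
  by have := p0 i; rewrite coef_poly ltn_ord inord_val coef0 mxE.
rewrite (@poly_comb_widen _ n.+1) ?size_poly //; apply: (can_inj v2rK).
rewrite linear0 -vM linear_sum; apply/rowP => j; rewrite summxE mxE.
apply: eq_bigr => i _; rewrite coef_poly ltn_ord inord_val linearZ !mxE.
by [].
Qed.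

End LieAlgebraTheory.

(** * Short gradings: invariance of the Killing pairing and nilpotency *)

Section ShortGrading.
Variables (C : numClosedFieldType) (L : lieAlgType C) (g : int -> {vspace L}).
Hypothesis gr : short_grading g.
Local Notation V := (jpair g).
Implicit Types (s : bool) (x y z u e f : L).

Lemma two_neq0 : 2%:R != 0 :> C.
Proof. by rewrite pnatr_eq0. Qed.

Lemma lie_jpair_same s x z : x \in V s -> z \in V s -> lie x z = 0.
Proof.
case: gr => _ _ g0 lieg; case: s => Vx Vz.
  by have := lieg _ _ _ _ Vx Vz; rewrite g0 // memv0 => /eqP.
by have := lieg _ _ _ _ Vx Vz; rewrite g0 // memv0 => /eqP.
Qed.

Lemma lie_jpair_opp s x y : x \in V s -> y \in V (~~ s) -> lie x y \in g 0.
Proof.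
by case: gr => _ _ _ lieg; case: s => Vx Vy; have := lieg _ _ _ _ Vx Vy.
Qed.

Lemma lie_g0_jpair s u x : u \in g 0 -> x \in V s -> lie u x \in V s.
Proof.
by case: gr => _ _ _ lieg; case: s => gu Vx; have := lieg _ _ _ _ gu Vx.
Qed.

Lemma jprod_jpair s x y z :
  x \in V s -> y \in V (~~ s) -> z \in V s -> jprod x y z \in V s.
Proof.
by move=> Vx Vy Vz; rewrite memvZ // lie_g0_jpair // (lie_jpair_opp Vx Vy).
Qed.

Lemma lie_lie_jprod x y z : lie (lie x y) z = 2%:R *: jprod x y z.
Proof. by rewrite scalerA divff ?scale1r // two_neq0. Qed.

Lemma killing_pairingZl s a x y :
  killing_pairing g s (a *: x) y = a * killing_pairing g s x y.
Proof.
rewrite -trace_onZ; apply: eq_in_trace_on => z _.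
by rewrite /jprod !lieZl !scalerA mulrC.
Qed.

Lemma killing_pairingZr s a x y :
  killing_pairing g s x (a *: y) = a * killing_pairing g s x y.
Proof.
rewrite -trace_onZ; apply: eq_in_trace_on => z _.
by rewrite /jprod lieZr lieZl !scalerA mulrC.
Qed.

Lemma killing_pairingDl s x1 x2 y : killing_pairing g s (x1 + x2) y =
  killing_pairing g s x1 y + killing_pairing g s x2 y.
Proof.
rewrite -trace_onD; apply: eq_in_trace_on => z _.
by rewrite /jprod !lieDl scalerDr.
Qed.

Lemma killing_pairingDr s x y1 y2 : killing_pairing g s x (y1 + y2) =
  killing_pairing g s x y1 + killing_pairing g s x y2.
Proof.
rewrite -trace_onD; apply: eq_in_trace_on => z _.
by rewrite /jprod lieDr lieDl scalerDr.
Qed.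

Lemma killing_pairingNl s x y :
  killing_pairing g s (- x) y = - killing_pairing g s x y.
Proof. by rewrite -scaleN1r killing_pairingZl mulN1r. Qed.

Lemma killing_pairingNr s x y :
  killing_pairing g s x (- y) = - killing_pairing g s x y.
Proof. by rewrite -scaleN1r killing_pairingZr mulN1r. Qed.

Lemma killing_pairing0r s x : killing_pairing g s x 0 = 0.
Proof. by rewrite -(scale0r 0) killing_pairingZr mul0r. Qed.

(** [B([u, x], y) + B(x, [u, y])] is the trace on [V s] of the commutator of [ad u] and [ad [x, y] /
    2]. *)
Lemma killing_pairing_invariant s u x y :
    u \in g 0 -> x \in V s -> y \in V (~~ s) ->
  killing_pairing g s (lie u x) y = - killing_pairing g s x (lie u y).
Proof.
move=> gu Vx Vy; apply/eqP; rewrite -addr_eq0 -trace_onD; apply/eqP.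
pose h := 2%:R^-1 *: lie x y.
have gh : h \in g 0 by rewrite memvZ ?(lie_jpair_opp Vx Vy).
transitivity (trace_on (V s) (fun z => lie u (lie h z) + -1 *: lie h (lie u z))).
  apply: eq_in_trace_on => z _; rewrite /jprod -scalerDr -lieDl -lie_leibniz.
  by rewrite lie_leibnizl scalerBr !lieZl lieZr scaleN1r.
rewrite trace_onD trace_onZ mulN1r; apply/eqP; rewrite subr_eq0; apply/eqP.
apply: (trace_on_comp (f1 := lie u) (f2 := lie h)) => z Vz;
  exact: lie_g0_jpair.
Qed.

(* Jacobson's lemma. *)
Lemma lie_jpair_nilpotent s e f z (h := lie e f) :
    e \in V s -> f \in V (~~ s) -> lie h e = 0 -> z \in V s ->
  lie h (lie h (lie h z)) = 0.
Proof.
move=> Ve Vf he Vz.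
have comm x : lie h (lie e x) = lie e (lie h x).
  by rewrite lie_leibniz he lie0l add0r.
have fe x : lie f (lie e x) = lie e (lie f x) - lie h x.
  by rewrite /h lie_leibnizl opprB addrC subrK.
have ge y : y \in V (~~ s) -> lie e y \in g 0 by exact: lie_jpair_opp.
(* Pushing [ad f] through [(ad e)^3 y = 0] leaves [- 3 [h, [e, [e, y]]]]. *)
have he2 y : y \in V (~~ s) -> lie h (lie e (lie e y)) = 0.
  move=> Vy; have : lie e (lie e (lie e y)) = 0.
    apply: (lie_jpair_same Ve); rewrite lieC memvN lie_g0_jpair //.
    exact: ge.
  move/(congr1 (lie f)); rewrite lie0r !fe (lie_jpair_same Vf Vy) lie0r add0r.
  rewrite !lieBr !lieNr -!comm -!opprD => /eqP; rewrite oppr_eq0.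
  rewrite -mulr2n -mulrSr -scaler_nat scaler_eq0 pnatr_eq0 /= => /eqP.
  by [].
(* Applying [ad h] after [ad f] to [(ad e)^2 u = 0] leaves [- 2 [h, [h, [e, u]]]], the other term
   vanishing by [he2] at [[f, u]]. *)
have h2e u : u \in g 0 -> lie h (lie h (lie e u)) = 0.
  move=> gu; have : lie e (lie e u) = 0.
    by apply: (lie_jpair_same Ve); rewrite lieC memvN lie_g0_jpair.
  move/(congr1 (fun x => lie h (lie f x))); rewrite lie0r !fe !lieBr lie0r.
  rewrite -!comm he2; last by rewrite lieC memvN lie_g0_jpair.
  rewrite sub0r -opprD -mulr2n -scaler_nat => /eqP.
  by rewrite oppr_eq0 scaler_eq0 pnatr_eq0 /= => /eqP.
rewrite [lie h z]lie_leibnizl (lie_jpair_same Ve Vz) lie0r subr0.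
by rewrite h2e // lieC memvN (lie_jpair_opp Vz Vf).
Qed.

(** * Positivity of the Hermitian form, and uniqueness of the inverse *)

Section JordanInvolution.
Variable w : L -> L.
Hypothesis jw : jordan_cartan_involution g w.

Lemma jinv_jpair s x : x \in V s -> w x \in V (~~ s).
Proof. by case: (jw s) => h _ _ _ _; exact: h. Qed.

Lemma jinvK s x : x \in V s -> w (w x) = x.
Proof. by case: (jw s) => _ _ h _ _; exact: h. Qed.

Lemma jinv0 : w 0 = 0.
Proof.
case: (jw true) => _ /(_ 1 0 0 (mem0v _) (mem0v _)) + _ _ _.
rewrite scaler0 addr0 rmorph1 scale1r => /eqP.
by rewrite -subr_eq0 opprD addNKr oppr_eq0 => /eqP.
Qed.

Lemma jinvZ s a x : x \in V s -> w (a *: x) = Num.conj a *: w x.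
Proof.
case: (jw s) => _ + _ _ _ => lw Vx.
by have := lw a x 0 Vx (mem0v _); rewrite !addr0 jinv0 addr0.
Qed.

Lemma jinvD s x y : x \in V s -> y \in V s -> w (x + y) = w x + w y.
Proof.
case: (jw s) => _ + _ _ _ => lw Vx Vy.
by have := lw 1 x y Vx Vy; rewrite rmorph1 !scale1r.
Qed.

Lemma jinvB s x y : x \in V s -> y \in V s -> w (x - y) = w x - w y.
Proof.
move=> Vx Vy; rewrite (jinvD (s := s)) ?memvN // -scaleN1r.
by rewrite (jinvZ (s := s)) // rmorphN1 scaleN1r.
Qed.

Lemma jinv_jprod s x y z : x \in V s -> y \in V (~~ s) -> z \in V s ->
  w (jprod x y z) = jprod (w x) (w y) (w z).
Proof. by case: (jw s) => _ _ _ h _ Vx Vy Vz; rewrite h. Qed.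

Lemma hform_eq0 s x : x \in V s -> hform g w s x x = 0 -> x = 0.
Proof.
case: (jw s) => _ _ _ _ pos Vx x0; apply/eqP; apply: contraT => /(pos _ Vx).
by rewrite x0 ltxx.
Qed.

(** Invariance moves [[x, w y]] across with a sign, absorbed by reversing the bracket. At [x = y]
    this makes [{x, w x, .}] Hermitian. *)
Lemma hform_adjoint s x y z v :
    x \in V s -> y \in V s -> z \in V s -> v \in V s ->
  hform g w s (jprod x (w y) z) v = hform g w s z (jprod y (w x) v).
Proof.
move=> Vx Vy Vz Vv.
have [[Wx Wy] Wv] := (jinv_jpair Vx, jinv_jpair Vy, jinv_jpair Vv).
rewrite /hform (jinv_jprod Vy Wx Vv) (jinvK Vx) /jprod.
rewrite killing_pairingZl killing_pairingZr.
rewrite killing_pairing_invariant // ?(lie_jpair_opp Vx Wy) //.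
by rewrite -killing_pairingNr -lieNl -lieC.
Qed.

(** If [T (T x) = 0] then [H(T x, T x) = H(x, T (T x)) = 0], so [T x = 0]; two such descents start
    from [T^3 = 0]. *)
Lemma hermitian_nilpotent s (T : L -> L) :
    {in V s, forall x, T x \in V s} -> hermitian_operator g w s T ->
    {in V s, forall x, T (T (T x)) = 0} -> {in V s, forall x, T x = 0}.
Proof.
move=> VT hT T3; have T2 : {in V s, forall x, T (T x) = 0 -> T x = 0}.
  move=> x Vx Tx0; apply: (hform_eq0 (VT _ Vx)).
  by rewrite hT ?VT // Tx0 /hform jinv0 killing_pairing0r.
by move=> x Vx; do 2!apply: (T2 _) => //; rewrite ?VT ?T3.
Qed.

Lemma jprod_hermitian_commuting_eq0 s e f z :
    e \in V s -> f \in V (~~ s) -> z \in V s -> lie (lie e f) e = 0 ->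
  hermitian_operator g w s (jprod e f) -> lie (lie e f) z = 0.
Proof.
move=> Ve Vf Vz he hT; rewrite lie_lie_jprod.
suff -> : jprod e f z = 0 by rewrite scaler0.
apply: (@hermitian_nilpotent s (jprod e f)) => // x Vx; first exact: jprod_jpair.
by rewrite /jprod !(lieZr, scalerA) (lie_jpair_nilpotent Ve Vf) ?scaler0.
Qed.

(** The Hermitian operator [{x, w x, .}] vanishes on [V s], and its trace is [H(x, x)]. *)
Lemma lie_self_commuting_eq0 s x :
  x \in V s -> lie (lie x (w x)) x = 0 -> x = 0.
Proof.
move=> Vx hx; have Wx := jinv_jpair Vx; apply: (hform_eq0 Vx).
rewrite /hform -(killing_pairing0r s x); apply: eq_in_trace_on => z Vz.
rewrite /jprod lie0r lie0l (jprod_hermitian_commuting_eq0 Vx Wx Vz) //.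
by move=> y1 y2 Vy1 Vy2; apply: hform_adjoint.
Qed.

(** With [y' = [u, y]], the value of [H] at [w y'] is [B(w y', y') = - B([u, w y'], y) = 0]. *)
Lemma lie_jpair_eq0_opp s u y : u \in g 0 -> y \in V (~~ s) ->
  {in V s, forall x, lie u x = 0} -> lie u y = 0.
Proof.
move=> gu Vy u0; set y' := lie u y.
have Vy' : y' \in V (~~ s) by exact: lie_g0_jpair.
have Wy' : w y' \in V s by rewrite -(negbK s) jinv_jpair.
rewrite -(jinvK Vy') (hform_eq0 Wy') ?jinv0 // /hform (jinvK Vy').
apply: oppr_inj; rewrite -killing_pairing_invariant // u0 //.
by rewrite -(scale0r 0) killing_pairingZl mul0r oppr0.
Qed.

Lemma jordan_MP_inverse_unique s A A1 A2 : A \in V s ->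
  jordan_MP_inverse g w s A A1 -> jordan_MP_inverse g w s A A2 -> A1 = A2.
Proof.
move=> VA [VA1 [e1 f1 h1 _]] [VA2 [e2 f2 h2 _]].
have lieA A' : jprod A' A A' = A' -> lie (lie A A') A' = - (2%:R *: A').
  by move=> jA; rewrite -[in RHS]jA -lie_lie_jprod -lieNl -lieC.
pose d := lie A (A1 - A2).
have dE : d = lie A A1 - lie A A2 by rewrite /d lieBr.
have V12 : A1 - A2 \in V (~~ s) by exact: memvB.
have gd : d \in g 0 by exact: lie_jpair_opp VA V12.
have dV : {in V s, forall x, lie d x = 0}.
  move=> x Vx; apply: (jprod_hermitian_commuting_eq0 VA V12 Vx).
    by rewrite -/d dE lieBl !lie_lie_jprod e1 e2 subrr.
  have jE y : jprod A (A1 - A2) y = jprod A A1 y - jprod A A2 y.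
    by rewrite /jprod lieBr lieBl scalerBr.
  move=> y1 y2 Vy1 Vy2; rewrite !jE {1}/hform killing_pairingDl killing_pairingNl.
  rewrite -!/(hform _ _ _ _ _) h1 // h2 // /hform -killing_pairingNr.
  by rewrite -killing_pairingDr (jinvB (s := s)) // jprod_jpair.
have dV' := lie_jpair_eq0_opp gd _ dV.
(* The left side is 0. The right side is [- 2 (A1 - A2)], since [d] kills [A2] and so [[A, A1]] acts
   on [A2] as [[A, A2]] does. *)
have : lie d A1 = lie (lie A A1) (A1 - A2).
  rewrite /d (lieC A) lieNl lie_swap ?(lie_jpair_same V12) //.
  by rewrite -lieNl -lieC.
rewrite dV' // lieBr lieA // -[X in lie X A2](subrK (lie A A2)) -dE lieDl dV' //.
rewrite add0r lieA // opprK -scalerN -scalerDr addrC => /esym/eqP.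
by rewrite scaler_eq0 (negPf two_neq0) subr_eq0 => /eqP.
Qed.

(** * Odd powers of an element, and existence of the inverse *)

Section OddPowers.
Variables (s : bool) (A : L).
Hypothesis VA : A \in V s.

(** For rectangular matrices, with [w] the conjugate transpose, this is [A (A^* A)^k]. *)
Definition odd_power k : L := iter k (jprod A (w A)) A.
Local Notation E := (poly_comb odd_power).
Local Notation F := (poly_comb (w \o odd_power)).
Local Notation "p ^c" := (map_poly Num.conj p) : ring_scope.
Implicit Types p q r : {poly C}.

Lemma odd_power_jpair k : odd_power k \in V s.
Proof.
by elim: k => [//|k IHk]; rewrite jprod_jpair // jinv_jpair.
Qed.

Lemma poly_comb_odd_power_jpair p : E p \in V s.
Proof. by apply: memv_suml => i _; rewrite memvZ ?odd_power_jpair. Qed.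

Lemma jinv_poly_comb p : w (E p) = F p^c.
Proof.
rewrite [RHS](@poly_comb_widen _ _ _ (size p)) ?size_poly //.
rewrite /poly_comb; elim: (size p) => [|n IHn]; first by rewrite !big_ord0 jinv0.
rewrite !big_ord_recr /= (jinvD (s := s)) ?memvZ ?odd_power_jpair //.
  by rewrite IHn (jinvZ _ (odd_power_jpair n)) coef_map.
by apply: memv_suml => i _; rewrite memvZ ?odd_power_jpair.
Qed.

Lemma map_poly_conjK : involutive (fun p => p^c).
Proof. by move=> p; apply/polyP => i; rewrite !coef_map /= conjCK. Qed.

(** From here to [ch0]: the hypotheses of [lie_powers] for the sequences [odd_power] and
    [w \o odd_power]. *)
Let ee k l : lie (odd_power k) (odd_power l) = 0.
Proof. by rewrite (lie_jpair_same (s := s)) ?odd_power_jpair. Qed.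

Let ff k l : lie (w (odd_power k)) (w (odd_power l)) = 0.
Proof. by rewrite (lie_jpair_same (s := ~~ s)) ?jinv_jpair ?odd_power_jpair. Qed.

Let he k : lie (lie A (w A)) (odd_power k) = 2%:R *: odd_power k.+1.
Proof. by rewrite lie_lie_jprod. Qed.

Let hf k : lie (lie A (w A)) (w (odd_power k)) = - (2%:R *: w (odd_power k.+1)).
Proof.
have Vk := odd_power_jpair k; rewrite /= (jinv_jprod VA (jinv_jpair VA) Vk).
by rewrite (jinvK VA) -lie_lie_jprod -lieNl -lieC.
Qed.

Let ch0 := @pchar_num C.

Lemma lie_odd_powers p q :
  lie (E p) (F q) = poly_comb (fun k => lie A (w (odd_power k))) (p * q).
Proof.
rewrite (lie_poly_comb (h := fun k => lie A (w (odd_power k))) (n := 0%N)).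
  by rewrite mulr1.
by move=> k l; rewrite addn0 (lie_powers ch0 ee ff he hf).
Qed.

Lemma jprod_odd_powers p q r : jprod (E p) (F q) (E r) = E (p * q * r * 'X).
Proof.
rewrite /jprod lie_odd_powers.
rewrite (lie_poly_comb (h := fun k => 2%:R *: odd_power k) (n := 1%N)).
  rewrite scaler_sumr; apply: eq_bigr => i _.
  by rewrite !scalerA mulrAC mulVf ?mul1r ?two_neq0.
by move=> k l; rewrite addn1 (lie_powers3 ch0 ee ff he hf).
Qed.

Lemma poly_comb_odd_power1 : E 1 = A.
Proof. by rewrite -(expr0 'X) poly_combXn. Qed.

(** Multiplication by ['X] acts as [{E 1, F 1, .}]; Horner induction on [q] then makes the
    annihilator of [A] an ideal. *)
Lemma poly_comb_odd_power_mul p q : E p = 0 -> E (q * p) = 0.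
Proof.
move=> p0; elim/poly_ind: q => [|q c IHq]; first by rewrite mul0r linear0.
rewrite mulrDl linearD /= mul_polyC linearZ /= p0 scaler0 addr0 mulrAC.
by rewrite -[q * p]mul1r -[1]mulr1 -jprod_odd_powers IHq /jprod lie0r scaler0.
Qed.

(** [{E p, w (E p), E p}] is [E] of a multiple of [p * 'X], hence zero. *)
Lemma odd_power_mulX_inj p : E (p * 'X) = 0 -> E p = 0.
Proof.
move=> pX0; have Vp := poly_comb_odd_power_jpair p.
apply: (lie_self_commuting_eq0 Vp).
rewrite lie_lie_jprod jinv_poly_comb jprod_odd_powers -mulrA.
by rewrite poly_comb_odd_power_mul ?scaler0.
Qed.

(** Commutativity of polynomials gives [[E p^c, w (E p^c)] = [E p^c, F p] = [E p, F p^c] = 0]. *)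
Lemma poly_comb_odd_power_conj p : E p = 0 -> E p^c = 0.
Proof.
move=> p0; apply: (lie_self_commuting_eq0 (poly_comb_odd_power_jpair _)).
rewrite jinv_poly_comb lie_odd_powers mulrC (map_poly_conjK p) -lie_odd_powers.
by rewrite p0 !lie0l.
Qed.

Lemma odd_power_generates : exists r, E (1 - r * 'X) = 0.
Proof.
have [p p0 Ep] := poly_comb_dependent odd_power.
(* Split off the largest power of ['X]: it cancels by [odd_power_mulX_inj], leaving [q] with [q.[0]
   != 0]. *)
have [m [q]] := multiplicity_XsubC p 0.
rewrite p0 /= subr0 => q0 pE.
have Eq : E q = 0.
  move: Ep; rewrite pE; elim: (m) => [|n IHn]; first by rewrite mulr1.
  by rewrite exprSr mulrA => /odd_power_mulX_inj/IHn.
have /factor_theorem[q' qE] : root (q - q.[0]%:P) 0.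
  by rewrite /root hornerD hornerN hornerC subrr.
(* Chosen so that [1 - r * 'X] is [q] scaled to constant term 1. *)
exists (- q.[0]^-1 *: q'); move: qE; rewrite subr0 => qE.
have -> : 1 - (- q.[0]^-1 *: q') * 'X = q.[0]^-1 *: q.
  rewrite scaleNr mulNr opprK -scalerAl -qE scalerBr addrC.
  by rewrite -[q.[0]%:P]alg_polyC scalerA mulVf // scale1r subrK.
by rewrite linearZ /= Eq scaler0.
Qed.

Lemma jordan_MP_inverse_exists : exists A', jordan_MP_inverse g w s A A'.
Proof.
have [r Er0] := odd_power_generates; have VEr := poly_comb_odd_power_jpair r.
have ErX : E (r * 'X) = A.
  rewrite -poly_comb_odd_power1; apply/esym/eqP.
  by rewrite -subr_eq0 -poly_combB Er0.
(* Modulo the annihilator, [r] and [r^c] both invert ['X], so they agree. *)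
have Erc : E r^c = E r.
  apply/eqP; rewrite -subr_eq0 -poly_combB; apply/eqP/odd_power_mulX_inj.
  rewrite mulrBl poly_combB /= ErX; apply/eqP; rewrite subr_eq0; apply/eqP.
  apply/esym/eqP; rewrite -subr_eq0 -poly_comb_odd_power1 -poly_combB.
  have := poly_comb_odd_power_conj Er0.
  by rewrite rmorphB rmorphM rmorph1 /= map_polyX => ->.
have wEr : w (E r) = F r by rewrite -Erc jinv_poly_comb map_poly_conjK.
have wA : w A = F 1 by rewrite -{1}poly_comb_odd_power1 jinv_poly_comb rmorph1.
(* By [hform_adjoint], this equality is what makes both operators Hermitian. *)
have lieE : lie A (w (E r)) = lie (E r) (w A).
  by rewrite wEr wA -{1}poly_comb_odd_power1 !lie_odd_powers mulrC.
have VwA := jinv_jpair VA; have VwEr := jinv_jpair VEr.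
exists (w (E r)); split=> //; split.
- rewrite wEr -{1 2}poly_comb_odd_power1 jprod_odd_powers mul1r mulr1.
  by rewrite ErX.
- rewrite -{1}(jinvK VA) -(jinv_jprod VEr VwA VEr) wA jprod_odd_powers mulr1.
  rewrite -mulrA; congr w; apply/esym/eqP; rewrite -subr_eq0 -poly_combB.
  by rewrite -{1}[r]mulr1 -mulrBr poly_comb_odd_power_mul.
- move=> x y Vx Vy; rewrite hform_adjoint //; congr (hform _ _ _ _ _).
  by rewrite /jprod lieE.
- move=> x y Vx Vy; rewrite -{1}(jinvK VA) hform_adjoint ?(jinvK VEr) //.
  by rewrite /jprod [lie (w A) _]lieC -lieE -lieC.
Qed.

End OddPowers.

(** * Comparison with the Lie-algebra definition *)

Section LieInvolution.
Variable wt : L -> L.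
Hypothesis simpleL : simple_lie L.
Hypothesis ntg : nontrivial_grading g.
Hypothesis cwt : corresponding_involutions g w wt.

(** The kernel of the action of [g 0] on [V_+] and [V_-] is an ideal, proper because the grading is
    nontrivial. *)
Lemma lie_jpair_faithful u :
  u \in g 0 -> (forall s, {in V s, forall x, lie u x = 0}) -> u = 0.
Proof.
move=> gu u0; have [dg sg _ lieg] := gr.
pose Z := (g 0 :&: \bigcap_(i : 'I_(\dim (V true)))
  lker (linfun (lie (vbasis (V true))`_i)) :&: \bigcap_(i : 'I_(\dim (V false)))
  lker (linfun (lie (vbasis (V false))`_i)))%VS.
have ZP v : reflect (v \in g 0 /\ forall s, {in V s, forall x, lie v x = 0}) (v \in Z).
  have capP s : reflect {in V s, forall x, lie v x = 0}
      (v \in \bigcap_(i : 'I_(\dim (V s))) lker (linfun (lie (vbasis (V s))`_i)))%VS.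
    apply: (iffP idP) => [vI x Vx | v0].
      rewrite (coord_vbasis Vx) lie_sumr big1 // => i _; rewrite lieZr lieC.
      move: vI; rewrite memvE => /subv_bigcapP/(_ i isT).
      by rewrite -memvE memv_ker lfunE /= => /eqP->; rewrite oppr0 scaler0.
    rewrite memvE; apply/subv_bigcapP => i _; rewrite -memvE memv_ker lfunE /=.
    by rewrite lieC v0 ?oppr0 // vbasis_mem ?mem_nth ?size_tuple.
  rewrite /Z !memv_cap -andbA; apply: (iffP and3P) => [[gv /capP t /capP f]|].
    by split=> // -[].
  by case=> gv v0; split=> //; apply/capP.
have Zideal : is_ideal Z.
  move=> x v /ZP[gv v0]; have : x \in fullv by exact: memvf.
  rewrite -sg => /memv_addP[_ /memv_addP[x1 V1 [x0 V0 ->]] [x2 V2 ->]].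
  rewrite !lieDl (lieC x1) (lieC x2) (v0 false) // (v0 true) // oppr0 add0r addr0.
  apply/ZP; split; first by have := lieg _ _ _ _ V0 gv.
  by move=> s y Vy; rewrite lie_leibnizl !(v0 s) ?lie0r ?subrr ?lie_g0_jpair.
have uZ : u \in Z by apply/ZP.
case: simpleL => _ /(_ Z Zideal)[Z0 | Zf]; first by move: uZ; rewrite Z0 memv0 => /eqP.
case: ntg; apply/eqP; rewrite eqEsubv subvf -Zf /=.
by apply/subvP => v /ZP[].
Qed.

(** For [h = [A, A']] the Jordan identities read [[h, A] = 2 A] and [[h, A'] = - 2 A'], and
    hermitianity amounts to [wt h = - h]. *)
Lemma jordan_lie_MP_inverse s A A' : A \in V s -> A' \in V (~~ s) ->
  jordan_MP_inverse g w s A A' <-> lie_MP_inverse g wt s A A'.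
Proof.
case: cwt => -[lwt wtK wtlie _] wtg wE VA VA'.
have wtZ a x : wt (a *: x) = Num.conj a *: wt x.
  have wt0 : wt 0 = 0.
    have := lwt 1 0 0; rewrite scaler0 addr0 /= rmorph1 scale1r => /eqP.
    by rewrite -subr_eq0 opprD addNKr oppr_eq0 => /eqP.
  by have := lwt a x 0; rewrite !addr0 wt0 addr0.
have wtN x : wt (- x) = - wt x by rewrite -scaleN1r wtZ rmorphN1 scaleN1r.
have wtD x y : wt (x + y) = wt x + wt y.
  by have := lwt 1 x y; rewrite /= rmorph1 !scale1r.
have gh := lie_jpair_opp VA VA'.
split=> [[_ [e1 f1 h1 _]] | [_ [h [[hE he hf] [u [gu wtu] hu]]]]].
- split=> //; exists (lie A A').
  set h := lie A A' in gh *.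
  have h0 : h + wt h = 0.
    have gwh : wt h \in g 0 by have := wtg 0 _ gh.
    (* For [y' = [h + wt h, y]], hermitianity at [w y'] and [w y] gives [B(w y', [h, y]) = - B(w y',
       [wt h, y])], so [H] vanishes at [w y']. *)
    have cent : {in V (~~ s), forall y, lie (h + wt h) y = 0}.
      move=> y Vy; have gh' : h + wt h \in g 0 by exact: memvD.
      pose y' := lie (h + wt h) y; have Vy' : y' \in V (~~ s) by exact: lie_g0_jpair.
      have Wy' : w y' \in V s by rewrite -(negbK s) jinv_jpair.
      have Wy : w y \in V s by rewrite -(negbK s) jinv_jpair.
      rewrite -/y' -(jinvK Vy') (hform_eq0 Wy') ?jinv0 // /hform (jinvK Vy').
      have := h1 _ _ Wy' Wy; rewrite /jprod /hform killing_pairingZl -/h.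
      have -> : w (2%:R^-1 *: lie h (w y)) = 2%:R^-1 *: lie (wt h) y.
        rewrite (wE s) ?memvZ ?lie_g0_jpair // wtZ wtlie rmorphV ?unitfE ?two_neq0 //.
        rewrite rmorph_nat -[wt (w y)]opprK -(wE s) // (jinvK Vy).
        by rewrite lieNr scalerN opprK.
      rewrite (jinvK Vy) killing_pairingZr killing_pairing_invariant // => /mulfI hk.
      have y'E : y' = lie h y + lie (wt h) y by rewrite /y' lieDl.
      by rewrite {2}y'E killing_pairingDr -hk ?invr_eq0 ?two_neq0 // subrr.
    apply: lie_jpair_faithful => [|t x Vx]; first exact: memvD.
    have [st|nst] := eqVneq (~~ s) t; first by apply: cent; rewrite st.
    apply: (lie_jpair_eq0_opp _ _ cent); first exact: memvD.
    by rewrite negbK; move: nst Vx; case: (s) (t) => -[].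
  split.
    split=> //; first by rewrite lie_lie_jprod e1.
    by rewrite /h (lieC A) lieNl lie_lie_jprod f1.
  have ii : 'i * 'i = -1 :> C by rewrite -expr2 sqrCi.
  (* As [wt] is antilinear, [wt h = - h] makes [- 'i *: h] a fixed point. *)
  exists (- 'i *: h).
    split; first by rewrite memvZ.
    rewrite wtZ rmorphN /= conjCi opprK; move/eqP: h0; rewrite addrC addr_eq0.
    by move/eqP->; rewrite scalerN scaleNr.
  by rewrite scalerA mulrN ii opprK scale1r.
- have gu' : h \in g 0 by rewrite -hE.
  have wth : wt h = - h by rewrite hu wtZ wtu conjCi scaleNr.
  (* Used with [a = 1/2] on [V s] and, since [[A', A] = - h], with [a = - 1/2] on [V (~~ s)]. *)
  have herm t a x y : a^* = a -> x \in V t -> y \in V t ->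
      hform g w t (a *: lie h x) y = hform g w t x (a *: lie h y).
    move=> ra Vx Vy; have Vhy := lie_g0_jpair gu' Vy.
    rewrite /hform killing_pairingZl (jinvZ _ Vhy) ra killing_pairingZr.
    rewrite killing_pairing_invariant ?jinv_jpair // (wE t _ Vhy) wtlie wth.
    by rewrite lieNl opprK (wE t) // lieNr killing_pairingNr opprK.
  split=> //; split.
  + by rewrite /jprod hE he scalerA mulVf ?two_neq0 ?scale1r.
  + rewrite /jprod (lieC A') lieNl hE hf opprK scalerA.
    by rewrite mulVf ?two_neq0 ?scale1r.
  + move=> x y Vx Vy; rewrite /jprod hE herm //.
    by rewrite rmorphV ?unitfE ?two_neq0 ?rmorph_nat.
  + move=> x y Vx Vy; rewrite /jprod (lieC A') hE !lieNl !scalerN -!scaleNr.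
    by rewrite herm // rmorphN rmorphV ?unitfE ?two_neq0 ?rmorph_nat.
Qed.

End LieInvolution.
End JordanInvolution.
End ShortGrading.

Theorem proposition3p3 (R : realType) (L : lieAlgType R[i])
    (g : int -> {vspace L}) (w : L -> L) :
  simple_lie L ->
  short_grading g ->
  nontrivial_grading g ->
  jordan_cartan_involution g w ->
  (forall wt : L -> L, corresponding_involutions g w wt ->
     forall (s : bool) (A A' : L),
       A \in jpair g s -> A' \in jpair g (~~ s) ->
       (jordan_MP_inverse g w s A A' <-> lie_MP_inverse g wt s A A')) /\
  (forall (s : bool) (A : L), A \in jpair g s ->
     exists! A' : L, jordan_MP_inverse g w s A A').
Proof.
move=> simpleL gr ntg jw; split.
  move=> wt cwt s A A' VA VA'.
  exact: (jordan_lie_MP_inverse gr jw simpleL ntg cwt VA VA').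
move=> s A VA; have [A' mpA'] := jordan_MP_inverse_exists gr jw VA.
by exists A'; split=> // A''; exact: (jordan_MP_inverse_unique gr jw VA mpA').
Qed.
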